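(* Let $W$ be a nonnegative random variable with distribution function $F$ and $\mathbb{E}[W^3]<\infty$. Consider either of the following weight sequences $\boldsymbol{w}=(w_1,\dots,w_n)$, $n\ge1$: (i) $w_i=[1-F]^{-1}(i/n)$ for $i=1,\dots,n$; or (ii) $w_1,\dots,w_n$ are i.i.d. copies of $W$. Then conditions (a), (b) and (c) hold with this $W$ (where in case (ii), the weights being random, they hold in probability): (a) $\max_{i\in[n]}w_i=o(n^{1/3})$; (b) $\frac1n\#\{i\in[n]: w_i\le x\}\to F(x)$ for every continuity point $x$ of $F$ (that is, $w_{V_n}\stackrel{d}{\longrightarrow}W$, where $V_n$ is uniform on $[n]$); (c) $\frac1n\sum_{i=1}^n w_i=\mathbb{E}[W]+o(n^{-1/3})$, $\frac1n\sum_{i=1}^n w_i^2=\mathbb{E}[W^2]+o(n^{-1/3})$, and $\frac1n\sum_{i=1}^n w_i^3=\mathbb{E}[W^3]+o(1)$.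
   Context: Here $[n]=\{1,\dots,n\}$. The generalized inverse is $[1-F]^{-1}(u)=\inf\{s: 1-F(s)\le u\}$ for $u\in(0,1)$, and by convention $[1-F]^{-1}(1)=0$. For random weights, ''hold in probability'' means that the $o(\cdot)$ terms are replaced by $o_{\mathbb{P}}(\cdot)$ (where $X_n=o_{\mathbb{P}}(b_n)$ means $|X_n|/b_n\to0$ in probability) and the convergence in (b) is convergence in probability. *)

(* Defs.v *)
From HB Require Import structures.
From mathcomp Require Import all_boot all_order all_algebra.
From mathcomp Require Import all_classical all_reals all_analysis.

Set Implicit Arguments.
Unset Strict Implicit.
Unset Printing Implicit Defensive.

Import Order.TTheory GRing.Theory Num.Theory.
Import numFieldNormedType.Exports.

Local Open Scope classical_set_scope.
Local Open Scope ring_scope.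

Definition distr_fun d (T : measurableType d) (R : realType)
    (P : probability T R) (W : {RV P >-> R}) (x : R) : R :=
  fine (cdf W x).

(* [E[W^k]] as a real number; [fine] is harmless whenever E[|W|^k] < oo. *)
Definition moment d (T : measurableType d) (R : realType)
    (P : probability T R) (W : {RV P >-> R}) (k : nat) : R :=
  fine 'E_P[(fun t => (W t ^+ k)%R)]%E.

(* [1 - F]^{-1}, for an argument u in (0, 1]. *)
Definition ccdf_inv (R : realType) (F : R -> R) (u : R) : R :=
  if u == 1 then 0 else inf [set s : R | 1 - F s <= u].

(* A weight vector (w_1, ..., w_n) is a function on 'I_n = {0, ..., n-1}, so
   that [w i] stands for w_{i+1}. *)
Section EmpiricalQuantities.
Context {R : realType} {n : nat}.
Implicit Types v : 'I_n -> R.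

(* The weights considered are (almost surely) nonnegative, so that taking 0 as
   the value of the empty maximum does not change the maximum for n >= 1. *)
Definition max_weight v : R := \big[Num.max/0]_(i < n) v i.

Definition emp_cdf v (x : R) : R := n%:R^-1 * #|[pred i | v i <= x]|%:R.

Definition emp_moment v (k : nat) : R := n%:R^-1 * \sum_(i < n) v i ^+ k.

End EmpiricalQuantities.

Definition quantile_weights (R : realType) (F : R -> R) (n : nat) (i : 'I_n) : R :=
  ccdf_inv F (i.+1%:R / n%:R).

(* Random variables indexed by n may live on probability spaces depending on
   n; a single probability space is the constant case. *)
Section InProbability.
Context {R : realType} {d : nat -> measure_display}.
Context {T : forall n, measurableType (d n)}.
Variable P : forall n, probability (T n) R.
Implicit Types X : forall n, T n -> R.

Definition cvg_in_prob X (c : R) : Prop :=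
  forall e : R, 0 < e ->
    P n [set t | e < `|X n t - c|] @[n --> \oo] --> 0%E.

Definition littleo_in_prob X (b : nat -> R) : Prop :=
  cvg_in_prob (fun n t => `|X n t| / b n) 0.

End InProbability.

Definition mutually_independent d (T : measurableType d) (R : realType)
    (P : probability T R) (n : nat) (X : 'I_n -> {RV P >-> R}) : Prop :=
  forall (J : {set 'I_n}) (B : 'I_n -> set R),
    (forall i, measurable (B i)) ->
    P (\bigcap_(i in [set` J]) (X i @^-1` B i)) =
    (\prod_(i in J) P (X i @^-1` B i))%E.

(* The laws are compared on Borel sets only: a [probability] is a total
   function on sets, unconstrained outside the measurable ones. *)
Definition same_law d (T : measurableType d) d' (T' : measurableType d')
    (R : realType) (P : probability T R) (Q : probability T' R)
    (X : {RV P >-> R}) (Y : {RV Q >-> R}) : Prop :=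
  forall B : set R, measurable B -> distribution P X B = distribution Q Y B.

Definition iid_copies d (T : measurableType d) d' (T' : measurableType d')
    (R : realType) (P : probability T R) (W : {RV P >-> R})
    (Q : probability T' R) (n : nat) (w : 'I_n -> {RV Q >-> R}) : Prop :=
  mutually_independent w /\ (forall i, same_law (w i) W).

Section Conditions.
Context {R : realType} {d : measure_display} {T : measurableType d}.
Context {P : probability T R}.
Variable W : {RV P >-> R}.

Section Deterministic.
Variable w : forall n, 'I_n -> R.

Definition max_condition : Prop :=
  (fun n => max_weight (@w n)) =o_\oo (fun n => n%:R `^ (1 / 3)).

Definition weak_cvg_condition : Prop :=
  forall x : R, {for x, continuous (distr_fun W)} ->
    emp_cdf (@w n) x @[n --> \oo] --> distr_fun W x.

Definition moment_condition : Prop :=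
  [/\ (fun n => emp_moment (@w n) 1 - moment W 1)
        =o_\oo (fun n => n%:R `^ (- (1 / 3))),
      (fun n => emp_moment (@w n) 2 - moment W 2)
        =o_\oo (fun n => n%:R `^ (- (1 / 3))) &
      (fun n => emp_moment (@w n) 3 - moment W 3)
        =o_\oo (fun=> 1 : R)].

End Deterministic.

Section Random.
Context {d' : nat -> measure_display} {T' : forall n, measurableType (d' n)}.
Context {Q : forall n, probability (T' n) R}.
Variable w : forall n, 'I_n -> {RV (Q n) >-> R}.

Definition max_condition_in_prob : Prop :=
  littleo_in_prob Q (fun n t => max_weight (fun i => @w n i t))
    (fun n => n%:R `^ (1 / 3)).

Definition weak_cvg_condition_in_prob : Prop :=
  forall x : R, {for x, continuous (distr_fun W)} ->
    cvg_in_prob Q (fun n t => emp_cdf (fun i => @w n i t) x) (distr_fun W x).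

Definition moment_condition_in_prob : Prop :=
  [/\ littleo_in_prob Q
        (fun n t => emp_moment (fun i => @w n i t) 1 - moment W 1)
        (fun n => n%:R `^ (- (1 / 3))),
      littleo_in_prob Q
        (fun n t => emp_moment (fun i => @w n i t) 2 - moment W 2)
        (fun n => n%:R `^ (- (1 / 3))) &
      littleo_in_prob Q
        (fun n t => emp_moment (fun i => @w n i t) 3 - moment W 3)
        (fun=> 1)].

End Random.
End Conditions.

(* Main.v *)
Require Import Defs.
From HB Require Import structures.
From mathcomp Require Import all_boot all_order all_algebra.
From mathcomp Require Import all_classical all_reals all_analysis.
From mathcomp Require Import measurable_realfun ring lra.

Set Implicit Arguments.
Unset Strict Implicit.
Unset Printing Implicit Defensive.

Import Order.TTheory GRing.Theory Num.Theory.
Import numFieldNormedType.Exports.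

Local Open Scope classical_set_scope.
Local Open Scope ring_scope.

(** The weights are compared with W through a cut at A = delta n^(1/3), where
    delta > 0 is fixed before n grows. Everything rests on one fact: since
    E[W^3] is finite, E[W^3; W > A] tends to 0 ([tail_moment_cvg0]). It gives
    n P(W > A) -> 0, which settles the maxima ([quantile_weights_le_cut] for the
    quantiles, a union bound in [max_weight_gt_bound] for the random weights),
    and it makes the contribution of W > A to a moment of order 1 or 2
    negligible with respect to n^(-1/3) ([tail_power_cut]). The case W >= 0
    almost surely reduces to W >= 0 everywhere since W and its positive part
    have the same law.

    Quantile weights. By the Galois connection [ccdf_inv_le] the empirical
    distribution function of the weights is within 1/n of F. For the moments,
    Abel summation expresses the sum of the w_i^k by means of the levels i/n,
    which lie between P(W > w_i) and P(W >= w_i). Hence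
    0 <= E[W^k] - (1/n) sum w_i^k <= 2 A^k / n + E[W^k; W > A]
    ([emp_moment_quantile_le], [emp_moment_quantile_ge]), and multiplying the
    right-hand side by n^(1/3), or by 1 if k = 3, leaves at most 3 delta in the
    limit.

    Independent weights. Chebyshev's inequality ([weak_law]) applied to the
    indicator of w_i <= x gives the convergence of the empirical distribution
    function. The variables W^2 and W^3 may have infinite variance, so that the
    powers are truncated first: with probability tending to 1 no weight exceeds
    A, the truncation bias is a tail moment, and the variance of the truncated
    mean is at most A^(2p-3) (1 + E[W^3]) / n, where p = 2 for the first two
    moments and p = 3 for the third one. Rescaled by the square of the rate,
    n^((3-p)/3), this variance is delta^(2p-3) (1 + E[W^3]), which is small
    with delta ([emp_moment_bound]). The rate being n^((3-p)/3) in all cases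
    allows a uniform treatment: the first two moments only use k <= p = 2. *)

(** * Real-valued integrals with respect to a probability *)

Section Integrals.
Context d (T : measurableType d) (R : realType) (P : probability T R).
Implicit Types (f g : T -> R) (A : set T).

Lemma bounded_integrable f M : measurable_fun setT f ->
  (forall t, `|f t| <= M) -> P.-integrable setT (EFin \o f).
Proof.
move=> mf fM; apply: measurable_bounded_integrable => //.
  by rewrite -ge0_fin_numE// fin_num_measure.
exists M; split; first exact: num_real.
by move=> x Mx t _; exact: le_trans (fM t) (ltW Mx).
Qed.

Lemma le_norm_integrable f g : measurable_fun setT f ->
  (forall t, `|f t| <= g t) -> P.-integrable setT (EFin \o g) ->
  P.-integrable setT (EFin \o f).
Proof.
move=> mf fg; apply: le_integrable => //; first exact/measurable_EFinP.
by move=> t _; rewrite /= lee_fin (le_trans (fg t)) ?ler_norm.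
Qed.

Lemma measurable_lt_set f g : measurable_fun setT f -> measurable_fun setT g ->
  measurable [set t | f t < g t].
Proof.
move=> mf mg; rewrite [X in measurable X](_ : _ = ~` [set t | g t <= f t]).
  apply: measurableC; rewrite -[X in measurable X]setTI.
  exact: measurable_fun_le.
by apply/seteqP; split => t /=; rewrite ltNge => /negP.
Qed.

Lemma Rintegral_cst_prob (c : R) : \int[P]_t c = c.
Proof.
have P1 : fine (P setT) = 1 by rewrite probability_setT.
by rewrite Rintegral_cst// [X in _ * X]P1 mulr1.
Qed.

Lemma Rintegral_indic A : measurable A -> \int[P]_t \1_A t = fine (P A).
Proof. by move=> mA; rewrite /Rintegral integral_indic// setIT. Qed.

Lemma indic_integrable A : measurable A -> P.-integrable setT (EFin \o \1_A).
Proof.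
move=> mA; apply: (@bounded_integrable _ 1) => [|t].
  exact: measurable_indic.
by rewrite indicE; case: (_ \in _); rewrite /= ?normr0 ?normr1.
Qed.

Lemma sum_integrable (I : Type) (s : seq I) (f : I -> T -> R) :
  (forall i, P.-integrable setT (EFin \o f i)) ->
  P.-integrable setT (EFin \o (fun t => \sum_(i <- s) f i t)).
Proof.
move=> fi; have -> : EFin \o (fun t => \sum_(j <- s) f j t) =
          (fun t => (\sum_(j <- s) (f j t)%:E)%E).
  by apply/funext => t /=; rewrite sumEFin.
by apply: integrable_sum => // i _; exact: fi.
Qed.

Lemma Rintegral_sum (I : Type) (s : seq I) (f : I -> T -> R) :
  (forall i, P.-integrable setT (EFin \o f i)) ->
  \int[P]_t (\sum_(i <- s) f i t) = \sum_(i <- s) \int[P]_t f i t.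
Proof.
move=> fi; elim: s => [|i s IHs].
  rewrite big_nil; under eq_Rintegral do rewrite big_nil.
  by rewrite Rintegral_cst// mul0r.
under eq_Rintegral do rewrite big_cons.
by rewrite big_cons RintegralD// ?IHs//; exact: sum_integrable.
Qed.

(** Markov's inequality for an arbitrary event A: it serves tail bounds,
    Chebyshev's inequality and union bounds alike. *)
Lemma markov_event g A c : measurable A -> P.-integrable setT (EFin \o g) ->
  (forall t, 0 <= g t) -> (forall t, A t -> c <= g t) ->
  c * fine (P A) <= \int[P]_t g t.
Proof.
move=> mA ig g0 cg; rewrite -Rintegral_indic// -RintegralZl//; last first.
  exact: indic_integrable.
apply: le_Rintegral => // [|t _].
  have := integrableZl measurableT c (indic_integrable mA).
  by apply: eq_integrable.
rewrite indicE; case: (boolP (t \in A)) => [/set_mem /cg|_].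
  by rewrite mulr1.
by rewrite mulr0.
Qed.

End Integrals.

(** * The tail of the third moment *)

Section NonnegativeVariable.
Context d (T : measurableType d) (R : realType) (P : probability T R).
Variable X : {RV P >-> R}.
Hypothesis X_ge0 : forall t, 0 <= X t.
Hypothesis X3_int : P.-integrable setT (EFin \o (fun t => X t ^+ 3)).

Lemma measurable_gt A : measurable [set t | A < X t].
Proof. exact: measurable_lt_set. Qed.

Lemma measurable_ge A : measurable [set t | A <= X t].
Proof. by rewrite -[X in measurable X]setTI; exact: measurable_fun_le. Qed.

Definition tail_moment A := \int[P]_t (X t ^+ 3 * \1_[set t | A < X t] t).

(** Tails and moments of order at most 3 are dominated by 1 + X^3. *)
Lemma tail_integrable k A : (k <= 3)%N ->
  P.-integrable setT (EFin \o (fun t => X t ^+ k * \1_[set t | A < X t] t)).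
Proof.
move=> k3; apply: (@le_norm_integrable _ _ _ _ _ (fun t => 1 + X t ^+ 3)).
- apply: measurable_funM; first exact: measurable_funX.
  exact/measurable_indic/measurable_gt.
- move=> t; have Xk : X t ^+ k <= 1 + X t ^+ 3.
    have [X1|X1] := leP (X t) 1.
      by rewrite (le_trans (exprn_ile1 _ _ _))// lerDl exprn_ge0.
    by rewrite (le_trans (ler_weXn2l (ltW X1) k3))// lerDr.
  rewrite ger0_norm ?mulr_ge0 ?exprn_ge0//.
  by rewrite (le_trans _ Xk)// ler_piMr ?exprn_ge0// indicE lern1 leq_b1.
- have -> : EFin \o (fun t => 1 + X t ^+ 3) =
            (EFin \o cst 1) \+ (EFin \o (fun t => X t ^+ 3)).
    by apply/funext => t /=.
  apply: integrableD => //.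
  by apply: (@bounded_integrable _ _ _ _ _ 1) => // t; rewrite normr1.
Qed.

Lemma moment_integrable k : (k <= 3)%N ->
  P.-integrable setT (EFin \o (fun t => X t ^+ k)).
Proof.
(* X is nonnegative, so that X > -1 always holds *)
move=> k3; have := tail_integrable (-1) k3; apply: eq_integrable => // t _ /=.
by rewrite indicE mem_set ?mulr1//= (lt_le_trans _ (X_ge0 t))// ltrN10.
Qed.

Lemma tail_moment_noninc A B : A <= B -> tail_moment B <= tail_moment A.
Proof.
move=> AB; apply: le_Rintegral => //; try exact: tail_integrable.
move=> t _; rewrite ler_wpM2l ?exprn_ge0// !indicE.
case: (boolP (t \in [set t | B < X t])) => // /set_mem /= BX.
by rewrite mem_set //=; exact: le_lt_trans BX.
Qed.

(** Dominated convergence: the third moment carried by the event X > A vanishes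
    as A grows. All the little-o statements come from this single fact. *)
Lemma tail_moment_cvg0 e : 0 < e -> \forall A \near +oo, tail_moment A <= e.
Proof.
move=> e0.
have : (\int[P]_t (X t ^+ 3 * \1_[set t | n%:R < X t] t)%:E)%E
    @[n --> \oo] --> (\int[P]_t (cst 0 t))%E.
  apply: (@dominated_cvg _ _ _ _ _ measurableT _ _
    (EFin \o (fun t => X t ^+ 3))) => //.
  - by move=> n; case/integrableP: (tail_integrable n%:R (leqnn 3)).
  - move=> t _; apply: cvg_near_cst; near=> n; rewrite indicE memNset ?mulr0//=.
    by apply/negP; rewrite -leNgt; near: n; exact: nbhs_infty_ger.
  - move=> n t _; rewrite /= lee_fin ger0_norm ?mulr_ge0 ?exprn_ge0//.
    by rewrite ler_piMr ?exprn_ge0// indicE lern1 leq_b1.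
rewrite integral0 => /fine_cvgP[_ /cvgr0Pnorm_lt /(_ _ e0)].
move=> [n _ /(_ n (leqnn n)) /= ne].
have te : tail_moment n%:R <= e by exact: le_trans (ler_norm _) (ltW ne).
near=> A; apply: le_trans te; apply: tail_moment_noninc.
by near: A; exact: nbhs_pinfty_ge.
Unshelve. all: by end_near. Qed.

End NonnegativeVariable.

(** * Finite sums along the grid i/n *)

Section GridSums.
Context {R : realType}.

Lemma grid_in01 n (i : 'I_n) : 0 < (i.+1%:R / n%:R : R) <= 1.
Proof.
have n0 : (0 < n)%N by case: n i => [[]|].
by rewrite divr_gt0 ?ltr0n//= ler_pdivrMr ?ltr0n// mul1r ler_nat.
Qed.

(** The maximum with 0 makes the induction on n go through when c > n, where
    the count is 0. *)
Lemma count_ge_bounds (c : R) n : 0 <= c ->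
  n%:R - c <= \sum_(i < n) (c <= i.+1%:R)%R%:R <= Num.max 0 (n%:R - c + 1).
Proof.
move=> c0; elim: n => [|n /andP[IHl IHu]].
  by rewrite big_ord0 le_max lexx/= sub0r oppr_le0 c0.
rewrite big_ord_recr/=; move: IHl IHu; set s := \sum_(i < n) _.
have s0 : 0 <= s by apply: sumr_ge0.
rewrite !le_max -natr1 => IHl IHu.
have [h|h] := leP c (n%:R + 1); apply/andP; split.
- by rewrite /=; lra.
- by rewrite /=; apply/orP; right; case/orP: IHu => ?; lra.
- by rewrite /=; lra.
- by rewrite /=; apply/orP; left; case/orP: IHu => ?; lra.
Qed.

(** Abel summation: it writes a sum of powers of the quantiles in terms of the
    levels i/n, which are what the distribution function controls. *)
Lemma sum_telescope_weighted (a : nat -> R) m :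
  \sum_(i < m) i.+1%:R * (a i - a i.+1) = \sum_(i < m) a i - m%:R * a m.
Proof.
elim: m => [|m IHm]; first by rewrite !big_ord0 mul0r subrr.
by rewrite !big_ord_recr/= IHm -natr1; ring.
Qed.

(** With a_i = q_i^k and b = X^k, this is the pointwise form of the bound from
    below on the moment of X: integration turns the indicators into
    probabilities of X >= q_i. When a decreases, the sum telescopes down to the
    first index i for which a_i <= b; the positive part is the case where there
    is no such index. *)
Lemma telescope_below (a : nat -> R) b m :
  \sum_(i < m) (a i <= b)%R%:R * (a i - a i.+1) <= Num.max 0 (b - a m).
Proof.
elim: m => [|m IHm]; first by rewrite big_ord0 le_max lexx.
rewrite big_ord_recr/=; move: IHm; set s := \sum_(i < m) _.
rewrite !le_max => IHm; have [h|h] := leP (a m) b; apply/orP; rewrite /=.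
  by right; case/orP: IHm => ?; lra.
by left; case/orP: IHm => ?; lra.
Qed.

(** The counterpart for upper bounds, with the indicators shifted by one
    index; this shift is the source of the error term of order a_0 / n. *)
Lemma telescope_above (a : nat -> R) b m :
  Num.min b (a 0) <=
  \sum_(i < m) (a i.+1 < b)%R%:R * (a i - a i.+1) + Num.min b (a m).
Proof.
elim: m => [|m IHm]; first by rewrite big_ord0 add0r.
rewrite big_ord_recr/=; apply: le_trans IHm _; rewrite -addrA lerD2l.
have [h|h] := ltP (a m.+1) b; rewrite /=.
  by rewrite mul1r subrK ge_min lexx orbT.
by rewrite mul0r add0r ge_min lexx.
Qed.

End GridSums.

(** * The generalized inverse of 1 - F *)

Section DistributionFunction.
Context d (T : measurableType d) (R : realType) (P : probability T R).
Variable X : {RV P >-> R}.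
Hypothesis X_ge0 : forall t, 0 <= X t.
Let F := distr_fun X.

Lemma prob_gt x : fine (P [set t | x < X t]) = 1 - F x.
Proof.
have -> : [set t | x < X t] = X @^-1` `]x, +oo[.
  by apply/seteqP; split => t /=; rewrite in_itv/= andbT.
have := cdf_ccdf_1 X x; rewrite -/(ccdf X x) /F /distr_fun => /(congr1 fine).
rewrite fineD ?fin_num_measure//= => <-.
by rewrite addrC addKr.
Qed.

Lemma distr_fun_ndecr x y : x <= y -> F x <= F y.
Proof.
by move=> xy; rewrite fine_le ?fin_num_measure// cdf_nondecreasing.
Qed.

Lemma distr_fun_le1 x : F x <= 1.
Proof. by rewrite -subr_ge0 -prob_gt fine_ge0. Qed.

Lemma distr_fun_ge0 x : 0 <= F x.
Proof. by rewrite fine_ge0. Qed.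

Lemma distr_fun_lt0 x : x < 0 -> F x = 0.
Proof.
move=> x0; have := prob_gt x.
have -> : [set t | x < X t] = setT.
  by apply/seteqP; split => t //= _; exact: lt_le_trans (X_ge0 t).
by rewrite probability_setT /=; lra.
Qed.

Lemma distr_fun_near1 u : 0 < u -> [set s | 1 - F s <= u] !=set0.
Proof.
move=> u0; have : F x @[x --> +oo] --> (1 : R).
  by have /fine_cvg := @cvg_cdfy1 _ _ _ _ X.
move=> /cvgr_ge /(_ (1 - u)); rewrite gtrBl => /(_ u0) [M [_ MF]].
by exists (M + 1); rewrite /= lerBlDr addrC -lerBlDr MF// ltrDl.
Qed.

Lemma distr_fun_quantile_ge0 u s : u < 1 -> 1 - F s <= u -> 0 <= s.
Proof.
move=> u1 Fs; rewrite leNgt; apply/negP => /distr_fun_lt0 F0.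
by move: Fs; rewrite F0 subr0 leNgt u1.
Qed.

Lemma ccdf_inv_ge0 u : 0 < u <= 1 -> 0 <= ccdf_inv F u.
Proof.
move=> /andP[u0 u1]; rewrite /ccdf_inv; case: eqVneq => // u_neq1.
apply: lb_le_inf => [|s]; first exact: distr_fun_near1.
by apply: distr_fun_quantile_ge0; rewrite lt_neqAle u_neq1.
Qed.

(** Galois connection between the generalized inverse and F: the infimum is
    attained since F is right continuous. The condition on x is there because
    the value at u = 1 is set to 0 by convention. *)
Lemma ccdf_inv_le u x : 0 < u <= 1 -> 0 <= x ->
  (ccdf_inv F u <= x) = (1 - F x <= u).
Proof.
move=> /andP[u0 u1] x0; rewrite /ccdf_inv; case: eqVneq => [->|u_neq1].
  by rewrite x0 gerBl distr_fun_ge0.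
set S := [set s | 1 - F s <= u].
have hlS : has_lbound S.
  by exists 0 => s; apply: distr_fun_quantile_ge0; rewrite lt_neqAle u_neq1.
apply/idP/idP => [Sx|Fx]; last exact: (ge_inf hlS).
have rc : F y @[y --> x^'+] --> F x.
  have := @cdf_right_continuous _ _ _ _ X x.
  rewrite -[cdf X x]fineK ?fin_num_measure//.
  by move/fine_cvg.
have Sy y : x < y -> 1 - F y <= u.
  move=> xy; have [s Ss sy] := inf_lt (distr_fun_near1 u0) (le_lt_trans Sx xy).
  by apply: le_trans Ss; rewrite lerB// distr_fun_ndecr// ltW.
rewrite lerBlDr addrC -lerBlDr.
rewrite -(cvg_lim _ rc)//; apply: limr_ge; first exact: cvgP rc.
near=> y; rewrite lerBlDr addrC -lerBlDr; apply: Sy.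
by near: y; exact: nbhs_right_gt.
Unshelve. all: by end_near. Qed.
(** Every s below the quantile has P(X > s) >= u, and the events X > s decrease
    to X >= q as s increases to q: this holds even if F jumps at q. *)
Lemma prob_ge_ccdf_inv u : 0 < u <= 1 ->
  u <= fine (P [set t | ccdf_inv F u <= X t]).
Proof.
move=> u01; set q := ccdf_inv F u.
have Pgt s : s < q -> u <= fine (P [set t | s < X t]).
  move=> sq; rewrite prob_gt; have [s0|s0] := leP 0 s.
    by rewrite ltW// ltNge -ccdf_inv_le// -ltNge.
  by rewrite distr_fun_lt0// subr0; case/andP: u01.
pose E n := [set t | q - n.+1%:R^-1 < X t].
have mE n : measurable (E n) by exact: measurable_gt.
have -> : [set t | q <= X t] = \bigcap_n E n.
  apply/seteqP; split => t /=.
    by move=> qX n _; apply: lt_le_trans qX; rewrite ltrBlDr ltrDl.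
  move=> EX; apply/ler_addgt0Pr => e e0.
  have [n _ /(_ n (leqnn n)) /= ne] := near_infty_natSinv_lt (PosNum e0).
  have := EX n I; rewrite /E/= ltrBlDr => /ltW/le_trans; apply.
  by rewrite lerD2l ltW.
have EP : P (E n) @[n --> \oo] --> P (\bigcap_n E n).
  apply: nonincreasing_cvg_mu => //.
  - by rewrite -ge0_fin_numE// fin_num_measure.
  - exact: bigcap_measurable.
  - move=> m n mn; apply/subsetPset => t; apply: le_lt_trans.
    by rewrite lerD2l lerN2 lef_pV2 ?posrE// ler_nat.
rewrite -lee_fin fineK ?fin_num_measure//; last exact: bigcap_measurable.
rewrite -(cvg_lim _ EP)//; apply: lime_ge; first exact: cvgP EP.
apply: nearW => n; rewrite -[P _]fineK ?fin_num_measure// lee_fin.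
by apply: Pgt; rewrite ltrBlDr ltrDl.
Qed.

Lemma prob_gt_ccdf_inv u : 0 < u <= 1 ->
  fine (P [set t | ccdf_inv F u < X t]) <= u.
Proof. by move=> u01; rewrite prob_gt -ccdf_inv_le ?ccdf_inv_ge0. Qed.

Lemma ccdf_inv_noninc u v : 0 < u -> u <= v -> v <= 1 ->
  ccdf_inv F v <= ccdf_inv F u.
Proof.
move=> u0 uv v1; have v0 := lt_le_trans u0 uv; have u1 := le_trans uv v1.
rewrite ccdf_inv_le ?v0 ?ccdf_inv_ge0 ?u0// (le_trans _ uv)//.
by rewrite -ccdf_inv_le ?u0 ?ccdf_inv_ge0 ?u0.
Qed.

End DistributionFunction.

(** * Quantile weights *)

Section EmpiricalQuantile.
Context d (T : measurableType d) (R : realType) (P : probability T R).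
Variable X : {RV P >-> R}.
Hypothesis X_ge0 : forall t, 0 <= X t.
Let F := distr_fun X.

(** By the Galois connection, w_i <= x amounts to i >= n (1 - F x), and there
    are n F(x) such integers i in [1, n] up to an error of 1. *)
Lemma emp_cdf_quantile_close n x : (0 < n)%N ->
  `|emp_cdf (@quantile_weights R F n) x - F x| <= n%:R^-1.
Proof.
move=> n0; have n0R : 0 < n%:R :> R by rewrite ltr0n.
have sumE : #|[pred i | @quantile_weights R F n i <= x]|%:R =
    \sum_(i < n) (@quantile_weights R F n i <= x)%R%:R :> R.
  rewrite -sum1_card natr_sum big_mkcond/=; apply: eq_bigr => i _.
  by rewrite inE; case: (_ <= _).
rewrite /emp_cdf sumE.
have [x0|x0] := leP 0 x; last first.
  rewrite big1 ?mulr0; last first.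
    move=> i _; rewrite leNgt (lt_le_trans x0)//.
    by apply: ccdf_inv_ge0 => //; exact: grid_in01.
  by rewrite /F distr_fun_lt0// subrr normr0 invr_ge0 ltW.
have F0 := distr_fun_ge0 X x; have F1 := distr_fun_le1 X x.
have c0 : 0 <= n%:R * (1 - F x) by rewrite mulr_ge0 ?subr_ge0.
under eq_bigr => i _.
  rewrite /quantile_weights ccdf_inv_le ?grid_in01// ler_pdivlMr// mulrC.
  over.
have := count_ge_bounds n c0; set s := \sum_(i < n) _.
rewrite le_max => /andP[sl su].
rewrite -(ler_pM2l n0R) mulfV ?gt_eqF// -[X in X * `|_|]gtr0_norm// -normrM.
rewrite mulrBr mulrA mulfV ?gt_eqF// mul1r ler_norml.
have nF0 : 0 <= n%:R * F x by rewrite mulr_ge0.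
by case/orP: su => su; apply/andP; split; lra.
Qed.

End EmpiricalQuantile.

Section QuantileMoments.
Context d (T : measurableType d) (R : realType) (P : probability T R).
Variable X : {RV P >-> R}.
Hypothesis X_ge0 : forall t, 0 <= X t.
Hypothesis X3_int : P.-integrable setT (EFin \o (fun t => X t ^+ 3)).
Let F := distr_fun X.

Lemma momentE k : moment X k = \int[P]_t (X t ^+ k).
Proof. by rewrite /moment unlock. Qed.

Section Grid.
Variables (m k : nat).
Hypothesis k0 : (0 < k)%N.
Hypothesis k3 : (k <= 3)%N.
Let n := m.+1.
(* indices start at 0: q i is the weight w_(i+1) and q m = w_n = 0 *)
Let q i := ccdf_inv F (i.+1%:R / n%:R).
Let a i := q i ^+ k.

Let u01 i : (i <= m)%N -> 0 < (i.+1%:R / n%:R : R) <= 1.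
Proof. by move=> im; have := @grid_in01 R n (@Ordinal n i im). Qed.

Let q_ge0 i : (i <= m)%N -> 0 <= q i.
Proof. by move=> im; apply: ccdf_inv_ge0 => //; exact: u01. Qed.

Let q_last : q m = 0.
Proof. by rewrite /q divff ?pnatr_eq0// /ccdf_inv eqxx. Qed.

Let a_last : a m = 0.
Proof. by rewrite /a q_last expr0n eqn0Ngt k0. Qed.

Let a_noninc i : (i < m)%N -> 0 <= a i - a i.+1.
Proof.
move=> im; rewrite subr_ge0 lerXn2r ?nnegrE ?q_ge0 ?(ltnW im)//.
have /andP[u0 _] := u01 (ltnW im); have /andP[_ u1] := u01 im.
apply: ccdf_inv_noninc => //.
by rewrite ler_pM2r ?invr_gt0 ?ltr0n// ler_nat.
Qed.

Let emp_sum : emp_moment (@quantile_weights R F n) k =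
  \sum_(i < m) i.+1%:R / n%:R * (a i - a i.+1).
Proof.
rewrite /emp_moment big_ord_recr/= -/(q m) -/(a m) a_last addr0.
under [RHS]eq_bigr do rewrite mulrAC mulrC.
rewrite -mulr_sumr sum_telescope_weighted a_last mulr0 subr0.
by congr (_ * _).
Qed.

(** Integrate [telescope_below] and use P(X >= q_i) >= (i+1)/n. *)
Lemma emp_moment_quantile_le :
  emp_moment (@quantile_weights R F n) k <= moment X k.
Proof.
rewrite emp_sum momentE.
pose h (i : 'I_m) t := (a i - a i.+1) * \1_[set t | q i <= X t] t.
have mq i : measurable [set t | q i <= X t] by exact: measurable_ge.
have ih i : P.-integrable setT (EFin \o h i).
  have := integrableZl measurableT (a i - a i.+1) (indic_integrable P (mq i)).
  by apply: eq_integrable.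
apply: (@le_trans _ _ (\int[P]_t \sum_(i < m) h i t)).
  rewrite Rintegral_sum//; apply: ler_sum => i _.
  rewrite RintegralZl//; last exact: indic_integrable.
  rewrite Rintegral_indic// mulrC ler_wpM2l ?a_noninc//.
  by apply: prob_ge_ccdf_inv => //; apply: u01; exact: ltnW.
apply: le_Rintegral => //; first exact: sum_integrable.
  exact: moment_integrable.
move=> t _; have := telescope_below a (X t ^+ k) m.
rewrite a_last subr0 max_r ?exprn_ge0//; apply: le_trans.
rewrite le_eqVlt; apply/orP; left; apply/eqP; apply: eq_bigr => i _.
rewrite /h mulrC indicE; congr (_%:R * _); congr nat_of_bool.
rewrite /a ler_pXn2r// ?nnegrE ?q_ge0 ?(ltnW (ltn_ord i))//.
by apply/idP/idP => [/set_mem|/mem_set].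
Qed.

(** Integrate [telescope_above] and use P(X > q_i) <= (i+1)/n. What exceeds the
    largest weight q_0 is cut at A: up to A it costs at most A^k P(X > q_0),
    hence A^k / n, and the rest is the tail. *)
Lemma emp_moment_quantile_ge A : q 0 <= A ->
  moment X k - emp_moment (@quantile_weights R F n) k <=
  2 * A ^+ k / n%:R + \int[P]_t (X t ^+ k * \1_[set t | A < X t] t).
Proof.
move=> qA; have A0 : 0 <= A by exact: le_trans (q_ge0 _) qA.
rewrite emp_sum momentE.
pose h (i : 'I_m) t := (a i - a i.+1) * \1_[set t | q i.+1 < X t] t.
pose g t := A ^+ k * \1_[set t | q 0 < X t] t.
have mq i : measurable [set t | q i < X t] by exact: measurable_gt.
have iZ c i :
    P.-integrable setT (EFin \o (fun t => c * \1_[set t | q i < X t] t)).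
  have := integrableZl measurableT c (indic_integrable P (mq i)).
  by apply: eq_integrable.
have intZ c i : 0 <= c -> (i <= m)%N ->
    \int[P]_t (c * \1_[set t | q i < X t] t) <= c * (i.+1%:R / n%:R).
  move=> c0 im; rewrite RintegralZl//; last exact: indic_integrable.
  rewrite Rintegral_indic// ler_wpM2l//.
  by apply: prob_gt_ccdf_inv => //; exact: u01.
have ih : P.-integrable setT (EFin \o (fun t => \sum_(i < m) h i t)).
  by apply: sum_integrable => i; exact: iZ.
have ig : P.-integrable setT (EFin \o g) by exact: iZ.
have ihg : P.-integrable setT (EFin \o (fun t => \sum_(i < m) h i t + g t)).
  by have := integrableD measurableT ih ig; apply: eq_integrable.
have it := tail_integrable X_ge0 X3_int A k3.
have le_int : \int[P]_t (X t ^+ k) <=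
    \int[P]_t ((\sum_(i < m) h i t + g t) + X t ^+ k * \1_[set t | A < X t] t).
  apply: le_Rintegral => //; first exact: moment_integrable.
    by have := integrableD measurableT ihg it; apply: eq_integrable.
  move=> t _; have Xk0 : 0 <= X t ^+ k by rewrite exprn_ge0.
  have := telescope_above a (X t ^+ k) m.
  have -> : \sum_(i < m) (a i.+1 < X t ^+ k)%R%:R * (a i - a i.+1) =
            \sum_(i < m) h i t.
    apply: eq_bigr => i _.
    rewrite /h [RHS]mulrC indicE; congr (_%:R * _); congr nat_of_bool.
    rewrite /a ltr_pXn2r// ?nnegrE ?q_ge0//.
    by apply/idP/idP => [/mem_set|/set_mem].
  rewrite a_last (min_r Xk0) addr0 => hle.
  have h0 : 0 <= \sum_(i < m) h i t.
    by apply: le_trans hle; rewrite le_min Xk0 exprn_ge0// q_ge0.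
  have [Xq|qX] := leP (X t) (q 0).
    have gt0 : 0 <= g t by rewrite mulr_ge0 ?exprn_ge0.
    have tt0 : 0 <= X t ^+ k * \1_[set t | A < X t] t by rewrite mulr_ge0.
    move: hle; rewrite min_l; first lra.
    by rewrite lerXn2r ?nnegrE ?q_ge0.
  have -> : g t = A ^+ k by rewrite /g indicE mem_set ?mulr1.
  have Ak0 : 0 <= A ^+ k by rewrite exprn_ge0.
  have [XA|AX] := leP (X t) A; last first.
    by rewrite indicE mem_set// mulr1; lra.
  have tt0 : 0 <= X t ^+ k * \1_[set t | A < X t] t by rewrite mulr_ge0.
  have : X t ^+ k <= A ^+ k by rewrite lerXn2r ?nnegrE.
  lra.
rewrite lerBlDl; apply: (le_trans le_int).
rewrite RintegralD// RintegralD// addrA lerD2r.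
have intg : \int[P]_t g t <= A ^+ k / n%:R.
  by have := intZ (A ^+ k) 0%N (exprn_ge0 _ A0) (leq0n _); rewrite mul1r.
have inth : \int[P]_t (\sum_(i < m) h i t) <=
    \sum_(i < m) i.+1%:R / n%:R * (a i - a i.+1) + a 0 / n%:R.
  rewrite Rintegral_sum; last by move=> i; exact: iZ.
  have -> : a 0 = \sum_(i < m) (a i - a i.+1).
    have -> : \sum_(i < m) (a i - a i.+1) = - \sum_(0 <= i < m) (a i.+1 - a i).
      by rewrite big_mkord -sumrN; apply: eq_bigr => i _; rewrite opprB.
    by rewrite telescope_sumr// a_last sub0r opprK.
  rewrite mulr_suml -big_split/=; apply: ler_sum => i _.
  have := intZ _ i.+1 (a_noninc (ltn_ord i)) (ltn_ord i) => /le_trans; apply.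
  by rewrite -[in leLHS]natr1 le_eqVlt; apply/orP; left; apply/eqP; ring.
have a0A : a 0 / n%:R <= A ^+ k / n%:R.
  by rewrite ler_wpM2r ?invr_ge0// lerXn2r ?nnegrE// q_ge0.
lra.
Qed.

End Grid.
End QuantileMoments.

(** * Weak law for bounded functions of independent variables *)

Section JointLaw.
Context d (T : measurableType d) (R : realType) (Q : probability T R).
Variables Y Z : {RV Q >-> R}.

Definition joint (t : T) : R * R := (Y t, Z t).

Lemma measurable_joint : measurable_fun setT joint.
Proof. exact: measurable_fun_pair. Qed.

HB.instance Definition _ :=
  isMeasurableFun.Build _ _ _ _ joint measurable_joint.

Hypothesis YZ_indep : forall A B : set R, measurable A -> measurable B ->
  Q (Y @^-1` A `&` Z @^-1` B) = (Q (Y @^-1` A) * Q (Z @^-1` B))%E.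

(** The joint law agrees with the product of the marginals on rectangles, hence
    everywhere, and the Fubini-Tonelli theorem splits the integral. *)
Lemma ge0_integral_indep (f g : R -> R) :
  measurable_fun setT f -> measurable_fun setT g ->
  (forall x, 0 <= f x) -> (forall x, 0 <= g x) ->
  (\int[Q]_t (f (Y t) * g (Z t))%:E =
   \int[Q]_t (f (Y t))%:E * \int[Q]_t (g (Z t))%:E)%E.
Proof.
move=> mf mg f0 g0.
pose h (z : R * R) : \bar R := (f z.1 * g z.2)%:E.
have mh : measurable_fun setT h.
  apply/measurable_EFinP; apply: measurable_funM.
    exact: (measurableT_comp mf measurable_fst).
  exact: (measurableT_comp mg measurable_snd).
have h0 z : (0 <= h z)%E by rewrite lee_fin mulr_ge0.
have jE : (\int[Q]_t h (joint t) = \int[distribution Q joint]_z h z)%E.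
  by rewrite ge0_integral_distribution.
rewrite [LHS]jE.
pose m1 : probability R R := distribution Q Y.
pose m2 : probability R R := distribution Q Z.
transitivity (\int[(m1 \x m2)%E]_z h z)%E.
  apply: eq_measure_integral => A mA _.
  apply/esym/product_measure_unique => // B C mB mC; exact: YZ_indep.
rewrite fubini_tonelli1// /fubini_F.
under eq_integral => x _.
  under eq_integral do rewrite /h/= EFinM.
  rewrite ge0_integralZl ?lee_fin//; last 2 first.
  - exact/measurable_EFinP.
  - by move=> y _; rewrite lee_fin.
  over.
rewrite ge0_integralZr//; last 3 first.
- exact/measurable_EFinP.
- by move=> y _; rewrite lee_fin.
- by apply: integral_ge0 => y _; rewrite lee_fin.
by congr (_ * _)%E; rewrite ge0_integral_distribution//; exact/measurable_EFinP.
Qed.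

Lemma Rintegral_indep (f g : R -> R) :
  measurable_fun setT f -> measurable_fun setT g ->
  (forall x, 0 <= f x) -> (forall x, 0 <= g x) ->
  Q.-integrable setT (EFin \o (f \o Y)) ->
  Q.-integrable setT (EFin \o (g \o Z)) ->
  \int[Q]_t (f (Y t) * g (Z t)) = \int[Q]_t f (Y t) * \int[Q]_t g (Z t).
Proof.
move=> mf mg f0 g0 fi gi; rewrite /Rintegral ge0_integral_indep//.
by rewrite fineM//; exact: integrable_fin_num.
Qed.
End JointLaw.

Section SameLaw.
Context d (T : measurableType d) d' (T' : measurableType d') (R : realType).
Context (P : probability T R) (Q : probability T' R).
Variables (X : {RV P >-> R}) (Y : {RV Q >-> R}).
Hypothesis XY : same_law Y X.

Lemma same_law_prob (B : set R) : measurable B ->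
  Q (Y @^-1` B) = P (X @^-1` B).
Proof. exact: XY. Qed.

Lemma same_law_integral (f : R -> R) : measurable_fun setT f ->
  (forall x, 0 <= f x) -> \int[Q]_t f (Y t) = \int[P]_t f (X t).
Proof.
move=> mf f0; rewrite /Rintegral; congr fine.
have mF : measurable_fun setT (EFin \o f) by exact/measurable_EFinP.
rewrite -(@ge0_integral_distribution _ _ _ _ _ Q Y (EFin \o f))//.
rewrite -(@ge0_integral_distribution _ _ _ _ _ P X (EFin \o f))//.
by apply: eq_measure_integral => A mA _; exact: XY.
Qed.

End SameLaw.

Section WeakLaw.
Context d (T : measurableType d) d' (T' : measurableType d') (R : realType).
Context (P : probability T R) (Q : probability T' R).
Variables (X : {RV P >-> R}) (n : nat) (w : 'I_n -> {RV Q >-> R}).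
Hypothesis iid : iid_copies X w.

Lemma iid_pair (i j : 'I_n) (A B : set R) : i != j ->
  measurable A -> measurable B ->
  Q (w i @^-1` A `&` w j @^-1` B) = (Q (w i @^-1` A) * Q (w j @^-1` B))%E.
Proof.
move=> ij mA mB; have [ind _] := iid.
have := ind [set i; j]%SET (fun l => if l == i then A else B).
rewrite big_setU1 ?inE//= big_set1 eqxx eq_sym (negbTE ij) => <-; last first.
  by move=> l; case: eqP.
congr (Q _); apply/seteqP; split => t /=.
  move=> [tA tB] l; rewrite /= !inE => /orP[] /eqP ->; first by rewrite eqxx.
  by rewrite eq_sym (negbTE ij).
move=> h; split.
  by have := h i; rewrite /= !inE eqxx => /(_ isT).
by have := h j; rewrite /= !inE eqxx orbT eq_sym (negbTE ij) => /(_ isT).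
Qed.

Variables (f : R -> R) (M : R).
Hypothesis mf : measurable_fun setT f.
Hypothesis f_ge0 : forall x, 0 <= f x.
Hypothesis f_leM : forall x, f x <= M.

Let f_norm x : `|f x| <= M. Proof. by rewrite ger0_norm. Qed.

Let mfw i : measurable_fun setT (f \o w i).
Proof. exact: measurableT_comp. Qed.

Let ifw i : Q.-integrable setT (EFin \o (f \o w i)).
Proof. by apply: bounded_integrable => // t; exact: f_norm. Qed.

Let ifw2 i j : Q.-integrable setT (EFin \o (fun t => f (w i t) * f (w j t))).
Proof.
apply: (@bounded_integrable _ _ _ _ _ (M * M)).
  exact: (measurable_funM (mfw i) (mfw j)).
by move=> t; rewrite normrM ler_pM.
Qed.

Let m := \int[P]_t f (X t).
Let m2 := \int[P]_t (f (X t) ^+ 2).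

Lemma cross_moment i j : i != j -> \int[Q]_t (f (w i t) * f (w j t)) = m ^+ 2.
Proof.
move=> ij; rewrite (@Rintegral_indep _ _ _ _ (w i) (w j))//; last first.
  by move=> A B mA mB; exact: iid_pair.
by rewrite !(same_law_integral (iid.2 _) mf f_ge0) expr2.
Qed.

(** The cross terms cancel by pairwise independence. The square is expanded
    without centring f since the product formula is for nonnegative
    functions. *)
Lemma variance_sum_le :
  \int[Q]_t ((\sum_(i < n) f (w i t) - n%:R * m) ^+ 2) <= n%:R * m2.
Proof.
have E t : (\sum_(i < n) f (w i t) - n%:R * m) ^+ 2 =
    \sum_(i < n) (\sum_(j < n) f (w i t) * f (w j t)
                  + (- (2 * n%:R * m)) * f (w i t)) + (n%:R * m) ^+ 2.
  rewrite big_split/=; set s := \sum_(i < n) f (w i t).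
  have -> : \sum_(i < n) \sum_(j < n) f (w i t) * f (w j t) = s * s.
    by rewrite mulr_suml; apply: eq_bigr => i _; rewrite mulr_sumr.
  by rewrite -mulr_sumr -/s; ring.
under eq_Rintegral do rewrite E.
have iS i :
    Q.-integrable setT (EFin \o (fun t => \sum_(j < n) f (w i t) * f (w j t))).
  by apply: sum_integrable => j; exact: ifw2.
have iZ (a : R) i : Q.-integrable setT (EFin \o (fun t => a * f (w i t))).
  by have := integrableZl measurableT a (ifw i); apply: eq_integrable.
have iD (a : R) i : Q.-integrable setT (EFin \o
    (fun t => \sum_(j < n) f (w i t) * f (w j t) + a * f (w i t))).
  by have := integrableD measurableT (iS i) (iZ a i); apply: eq_integrable.
rewrite RintegralD//; last 2 first.
- by apply: sum_integrable => i; exact: iD.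
- by apply: (@bounded_integrable _ _ _ _ _ `|(n%:R * m) ^+ 2|).
rewrite Rintegral_cst_prob Rintegral_sum//.
have sE i : \int[Q]_t (\sum_(j < n) f (w i t) * f (w j t) +
      - (2 * n%:R * m) * f (w i t)) <= m2 + (n%:R - 2 * n%:R) * m ^+ 2.
  rewrite RintegralD// RintegralZl; [|by []|exact: ifw].
  rewrite (@Rintegral_sum _ _ _ _ _ _ (fun j t => f (w i t) * f (w j t)))//.
  rewrite (same_law_integral (iid.2 i) mf f_ge0) -/m (bigD1 i)//=.
  under eq_Rintegral do rewrite -expr2.
  rewrite (same_law_integral (f := fun x => f x ^+ 2) (iid.2 i))//;
    last 2 first.
  - exact: measurable_funX.
  - by move=> x; exact: sqr_ge0.
  rewrite (eq_bigr (fun=> m ^+ 2)); last first.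
    by move=> j ji; rewrite cross_moment// eq_sym.
  rewrite sumr_const cardC1 card_ord -/m2.
  have n0 : (0 < n)%N by case: (n) i => [[]|].
  have : 0 <= m ^+ 2 by exact: sqr_ge0.
  have -> : m ^+ 2 *+ n.-1 = (n%:R - 1) * m ^+ 2.
    by rewrite -mulr_natl -[in RHS](prednK n0) -natr1 addrK.
  by rewrite expr2; lra.
apply: (le_trans (lerD (ler_sum _ (fun i _ => sE i)) (lexx _))).
rewrite sumr_const card_ord -mulr_natl; nra.
Qed.

Lemma measurable_mean_dev :
  measurable_fun setT (fun t => `|n%:R^-1 * (\sum_(i < n) f (w i t)) - m|).
Proof.
apply: measurableT_comp => //; apply: measurable_funB => //.
by apply: measurable_funM => //; apply: measurable_sum => i; exact: mfw.
Qed.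

(** Chebyshev's inequality; the bound decreases like 1/n since the variance of
    the sum is linear in n. *)
Lemma weak_law e : (0 < n)%N -> 0 < e ->
  fine (Q [set t | e < `|n%:R^-1 * (\sum_(i < n) f (w i t)) - m|]) <=
  m2 / (n%:R * e ^+ 2).
Proof.
move=> n0 e0; have n0R : 0 < n%:R :> R by rewrite ltr0n.
pose S t := \sum_(i < n) f (w i t).
have mS : measurable_fun setT S by apply: measurable_sum => i; exact: mfw.
rewrite ler_pdivlMr ?mulr_gt0 ?exprn_gt0//.
rewrite -(ler_pM2l n0R); apply: le_trans variance_sum_le.
set q := fine _; have -> : n%:R * (q * (n%:R * e ^+ 2)) = (n%:R * e) ^+ 2 * q.
  by ring.
apply: markov_event.
- by apply: measurable_lt_set => //; exact: measurable_mean_dev.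
- apply: (@bounded_integrable _ _ _ _ _ ((n%:R * M + n%:R * `|m|) ^+ 2)).
    by apply: measurable_funX; apply: measurable_funB.
  move=> t; rewrite normrX lerXn2r ?nnegrE ?addr_ge0 ?mulr_ge0
    ?(le_trans _ (f_norm 0))//.
  rewrite (le_trans (ler_normB _ _))// lerD//; last by rewrite normrM normr_nat.
  rewrite (le_trans (ler_norm_sum _ _ _))//.
  rewrite (le_trans (ler_sum _ (fun i _ => f_norm _)))//.
  by rewrite sumr_const card_ord mulr_natl.
- by move=> t; exact: sqr_ge0.
- move=> t /= et; have ne0 : 0 <= n%:R * e by apply: mulr_ge0; exact: ltW.
  rewrite -[leRHS]real_normK ?num_real// lerXn2r ?nnegrE//.
  have -> : \sum_(i < n) f (w i t) - n%:R * m = n%:R * (n%:R^-1 * S t - m).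
    by rewrite mulrBr mulrA mulfV ?gt_eqF// mul1r.
  by rewrite normrM normr_nat ler_pM2l// ltW.
Qed.

End WeakLaw.

(** * Truncation at delta n^(1/3) *)

Section Truncation.
Context d (T : measurableType d) (R : realType) (P : probability T R).
Variable X : {RV P >-> R}.
Hypothesis X_ge0 : forall t, 0 <= X t.
Hypothesis X3_int : P.-integrable setT (EFin \o (fun t => X t ^+ 3)).
Let F := distr_fun X.

(** The cut at 0 as well makes the function nonnegative and bounded on the whole
    line, which is needed to compose it with weights of arbitrary sign. *)
Definition trunc_power (A : R) (k : nat) (x : R) : R := x ^+ k * \1_(`[0, A]) x.

Lemma measurable_trunc_power A k : measurable_fun setT (trunc_power A k).
Proof.
by apply: measurable_funM; [exact: exprn_measurable | exact: measurable_indic].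
Qed.

Lemma trunc_power_in A k x : 0 <= x -> x <= A -> trunc_power A k x = x ^+ k.
Proof.
by move=> x0 xA; rewrite /trunc_power indicE mem_set ?mulr1//= in_itv/= x0.
Qed.

Lemma trunc_power_out A k x : A < x -> trunc_power A k x = 0.
Proof.
move=> Ax; rewrite /trunc_power indicE memNset ?mulr0//= in_itv/=.
by apply/negP; rewrite (leNgt x) Ax andbF.
Qed.

Lemma trunc_power_ge0 A k x : 0 <= trunc_power A k x.
Proof.
rewrite /trunc_power indicE; case: (boolP (x \in _)); last by rewrite mulr0.
by move=> /set_mem /=; rewrite in_itv/= mulr1 => /andP[x0 _]; exact: exprn_ge0.
Qed.

Lemma trunc_power_le A k x : 0 <= A -> trunc_power A k x <= A ^+ k.
Proof.
move=> A0; rewrite /trunc_power indicE; case: (boolP (x \in _)).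
  move=> /set_mem /=; rewrite in_itv/= mulr1 => /andP[x0 xA].
  by rewrite lerXn2r ?nnegrE.
by rewrite mulr0 exprn_ge0.
Qed.

Lemma trunc_moment A k : (k <= 3)%N ->
  \int[P]_t trunc_power A k (X t) =
  moment X k - \int[P]_t (X t ^+ k * \1_[set t | A < X t] t).
Proof.
move=> k3; rewrite momentE -RintegralB//; last 2 first.
- exact: moment_integrable.
- exact: tail_integrable.
apply: eq_Rintegral => t _.
have [XA|AX] := leP (X t) A.
  rewrite trunc_power_in// indicE memNset ?mulr0 ?subr0//=.
  by apply/negP; rewrite -leNgt.
by rewrite trunc_power_out// indicE mem_set// mulr1 subrr.
Qed.

Lemma prob_gt_tail A : 0 <= A ->
  A ^+ 3 * fine (P [set t | A < X t]) <= tail_moment X A.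
Proof.
move=> A0; apply: markov_event.
- exact: measurable_gt.
- exact: tail_integrable.
- by move=> t; rewrite mulr_ge0 ?exprn_ge0.
- move=> t AX; rewrite indicE mem_set// mulr1 lerXn2r ?nnegrE//.
  exact: ltW.
Qed.

(** The exponent p stands for 2 (moments of order 1 and 2, at rate n^(1/3)) or 3
    (third moment, at rate 1); A >= 1 lets X^k be replaced by X^p above A. *)
Section Exponents.
Variables (A : R) (p k : nat).
Hypothesis A1 : 1 <= A.
Hypothesis p23 : (2 <= p <= 3)%N.
Hypothesis kp : (k <= p)%N.

Let p2 : (2 <= p)%N. Proof. by case/andP: p23. Qed.
Let p3 : (p <= 3)%N. Proof. by case/andP: p23. Qed.
Let A0 : 0 <= A. Proof. exact: le_trans A1. Qed.

Lemma tail_power_le :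
  A ^+ (3 - p) * \int[P]_t (X t ^+ k * \1_[set t | A < X t] t) <=
  tail_moment X A.
Proof.
have it := tail_integrable X_ge0 X3_int A (leq_trans kp p3).
rewrite -RintegralZl//; apply: le_Rintegral => //.
- by have := integrableZl measurableT (A ^+ (3 - p)) it; apply: eq_integrable.
- exact: tail_integrable.
move=> t _; rewrite indicE; case: (boolP (t \in _)) => [/set_mem /= AX|_].
  have X1 : 1 <= X t by rewrite (le_trans A1)// ltW.
  rewrite !mulr1 -[in leRHS](subnK p3) exprD ler_pM ?exprn_ge0//.
    by rewrite lerXn2r ?nnegrE// ltW.
  exact: ler_weXn2l.
by rewrite !mulr0.
Qed.

(** For 1 <= X <= A, X^(2k) <= X^(2p-3) X^3 <= A^(2p-3) X^3: only the third
    moment is needed to control the truncated moment of order 2k, up to 6. *)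
Lemma trunc_moment2_le :
  \int[P]_t (trunc_power A k (X t) ^+ 2) <=
  A ^+ (2 * p - 3) * (1 + moment X 3).
Proof.
have i3 : P.-integrable setT (EFin \o (fun t => 1 + X t ^+ 3)).
  have i1 : P.-integrable setT (EFin \o cst 1).
    by apply: (@bounded_integrable _ _ _ _ _ 1) => // t; rewrite normr1.
  by have := integrableD measurableT i1 X3_int; apply: eq_integrable.
have -> : 1 + moment X 3 = \int[P]_t (1 + X t ^+ 3).
  rewrite RintegralD//; first by rewrite Rintegral_cst_prob momentE.
  by apply: (@bounded_integrable _ _ _ _ _ 1) => // t; rewrite normr1.
rewrite -RintegralZl//; apply: le_Rintegral => //.
- apply: (@bounded_integrable _ _ _ _ _ ((A ^+ k) ^+ 2)).
    apply: measurable_funX; apply: measurableT_comp => //.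
    exact: measurable_trunc_power.
  move=> t; rewrite normrX lerXn2r ?nnegrE ?exprn_ge0//.
  by rewrite ger0_norm ?trunc_power_ge0 ?trunc_power_le.
- have := integrableZl measurableT (A ^+ (2 * p - 3)) i3.
  by apply: eq_integrable.
move=> t _; have r0 : 0 <= A ^+ (2 * p - 3) * (1 + X t ^+ 3).
  by rewrite mulr_ge0 ?addr_ge0 ?exprn_ge0.
have [XA|AX] := leP (X t) A; last by rewrite trunc_power_out// expr0n.
rewrite trunc_power_in//; have [X1|X1] := leP (X t) 1.
  apply: (@le_trans _ _ 1); first by rewrite !exprn_ile1 ?exprn_ge0.
  rewrite (le_trans (_ : 1 <= A ^+ (2 * p - 3)))//; first exact: exprn_ege1.
  by rewrite ler_peMr ?exprn_ge0// lerDl exprn_ge0.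
apply: (@le_trans _ _ (X t ^+ (2 * p - 3) * X t ^+ 3)).
  rewrite -exprD subnK; last by rewrite (leq_trans _ (leq_mul (leqnn 2) p2)).
  by rewrite -exprM mulnC; apply: ler_weXn2l; [exact: ltW | rewrite leq_mul2l].
rewrite ler_pM ?exprn_ge0//; first by rewrite lerXn2r ?nnegrE.
by rewrite lerDr.
Qed.

End Exponents.

(** N is the cube root of n; working with N keeps all exponents integral. *)
Section Rates.
Variables (n : nat) (N delta : R).
Hypothesis n_gt0 : (0 < n)%N.
Hypothesis N_gt0 : 0 < N.
Hypothesis N3 : N ^+ 3 = n%:R.
Hypothesis delta_gt0 : 0 < delta.
Hypothesis delta_le1 : delta <= 1.
Let A := delta * N.
Hypothesis A_ge1 : 1 <= A.

Let A_ge0 : 0 <= A. Proof. exact: le_trans A_ge1. Qed.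
Let n_gt0R : 0 < n%:R :> R. Proof. by rewrite ltr0n. Qed.

Lemma prob_gt_cut c : tail_moment X A <= delta ^+ 3 * c ->
  n%:R * fine (P [set t | A < X t]) <= c.
Proof.
move=> tA; have := le_trans (prob_gt_tail A_ge0) tA.
by rewrite /A exprMn N3 -mulrA ler_pM2l// exprn_gt0.
Qed.

(** The rate N^(3-p) is A^(3-p) / delta^(3-p), and multiplied by A^(3-p) the
    tail of X^k is at most the tail of X^3. *)
Lemma tail_power_cut p k c : (2 <= p <= 3)%N -> (k <= p)%N ->
  tail_moment X A <= delta ^+ 3 * c -> 0 <= c ->
  N ^+ (3 - p) * \int[P]_t (X t ^+ k * \1_[set t | A < X t] t) <= delta * c.
Proof.
move=> p23 kp tA c0; have /andP[p2 p3] := p23.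
have := le_trans (tail_power_le A_ge1 p23 kp) tA.
rewrite /A exprMn -[in leRHS](subnK p3) exprD -!mulrA.
rewrite ler_pM2l ?exprn_gt0// => h.
apply: (le_trans h); rewrite ler_wpM2r//.
by rewrite -[leRHS]expr1 ler_wiXn2l ?(ltW delta_gt0)// (leq_trans _ p2).
Qed.

(** The largest weight is at most A as soon as P(X > A) <= 1/n. *)
Lemma quantile_weights_le_cut (i : 'I_n) : tail_moment X A <= delta ^+ 3 ->
  @quantile_weights R F n i <= A.
Proof.
move=> tA; rewrite ccdf_inv_le ?grid_in01// -prob_gt ler_pdivlMr// mulrC.
have := @prob_gt_cut 1; rewrite mulr1 => /(_ tA)/le_trans; apply.
by rewrite ler1n.
Qed.

Lemma quantile_moment_rate p k : (2 <= p <= 3)%N -> (0 < k <= p)%N ->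
  tail_moment X A <= delta ^+ 3 ->
  `|emp_moment (@quantile_weights R F n) k - moment X k| * N ^+ (3 - p) <=
  3 * delta.
Proof.
move=> p23 /andP[k0 kp] tA.
have /andP[p2 p3] := p23; have k3 := leq_trans kp p3.
have tP := @tail_power_cut p k 1 p23 kp.
rewrite !mulr1 in tP; have {}tP := tP tA ler01.
have [m nE] : exists m, n = m.+1 by case: (n) n_gt0 => // m _; exists m.
have le_mom : emp_moment (@quantile_weights R F n) k <= moment X k.
  by rewrite nE; exact: emp_moment_quantile_le.
rewrite distrC ger0_norm ?subr_ge0//.
have ge_mom : moment X k - emp_moment (@quantile_weights R F n) k <=
    2 * A ^+ k / n%:R + \int[P]_t (X t ^+ k * \1_[set t | A < X t] t).
  rewrite nE; apply: emp_moment_quantile_ge => //.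
  have := quantile_weights_le_cut (Ordinal n_gt0) tA.
  by rewrite /quantile_weights/= nE.
have Np0 : 0 <= N ^+ (3 - p) by rewrite exprn_ge0// ltW.
apply: (le_trans (ler_wpM2r Np0 ge_mom)).
rewrite mulrDl [X in _ + X]mulrC.
suff : 2 * A ^+ k / n%:R * N ^+ (3 - p) <= 2 * delta by lra.
rewrite -!mulrA ler_pM2l//.
apply: (@le_trans _ _ (A ^+ p * (n%:R^-1 * N ^+ (3 - p)))).
  rewrite ler_wpM2r ?mulr_ge0 ?invr_ge0 ?(ltW n_gt0R)//.
  exact: ler_weXn2l.
rewrite mulrA mulrAC -(ler_pM2r n_gt0R) mulfVK ?gt_eqF//.
rewrite /A exprMn -mulrA -exprD subnKC// N3 ler_pM2r//.
by rewrite -[leRHS]expr1 ler_wiXn2l ?(ltW delta_gt0)// (leq_trans _ p2).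
Qed.

End Rates.
End Truncation.

(** * Bounds in probability for independent weights *)

Section UnionBound.
Context d (T : measurableType d) (R : realType) (Q : probability T R).

Lemma union_bound n (A : 'I_n -> set T) (D E : set T) :
  (forall i, measurable (A i)) -> measurable D -> measurable E ->
  (forall t, E t -> (exists i, A i t) \/ D t) ->
  fine (Q E) <= \sum_(i < n) fine (Q (A i)) + fine (Q D).
Proof.
move=> mA mD mE EAD.
have iA : Q.-integrable setT (EFin \o (fun t => \sum_(i < n) \1_(A i) t)).
  by apply: sum_integrable => i; exact: indic_integrable.
have iD := indic_integrable Q mD.
apply: (@le_trans _ _ (\int[Q]_t (\sum_(i < n) \1_(A i) t + \1_D t))).
  rewrite -[leLHS]mul1r; apply: markov_event => //.
  - by have := integrableD measurableT iA iD; apply: eq_integrable.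
  - by move=> t; rewrite addr_ge0// sumr_ge0.
  - move=> t /EAD[[i Ait]|Dt].
      rewrite (bigD1 i)//= indicE mem_set// -addrA lerDl addr_ge0// sumr_ge0//.
    by rewrite [\1_D t]indicE mem_set// lerDr sumr_ge0.
rewrite RintegralD// Rintegral_indic// lerD2r Rintegral_sum//.
  by apply: ler_sum => i _; rewrite Rintegral_indic.
by move=> i; exact: indic_integrable.
Qed.

End UnionBound.

Section IidBounds.
Context d (T : measurableType d) d' (T' : measurableType d') (R : realType).
Context (P : probability T R) (Q : probability T' R).
Variables (X : {RV P >-> R}) (n : nat) (w : 'I_n -> {RV Q >-> R}).
Hypothesis X_ge0 : forall t, 0 <= X t.
Hypothesis X3_int : P.-integrable setT (EFin \o (fun t => X t ^+ 3)).
Hypothesis iid : iid_copies X w.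
Hypothesis n_gt0 : (0 < n)%N.

Let n_gt0R : 0 < n%:R :> R. Proof. by rewrite ltr0n. Qed.

Let prob_gtE i a :
  fine (Q [set t | a < w i t]) = fine (P [set t | a < X t]).
Proof.
have E d1 (T1 : measurableType d1) (P1 : probability T1 R) (Z : {RV P1 >-> R}) :
    [set t | a < Z t] = Z @^-1` `]a, +oo[.
  by apply/seteqP; split => t /=; rewrite in_itv/= andbT.
by rewrite !E (same_law_prob (iid.2 i)).
Qed.

Lemma max_weight_gt_bound a : 0 <= a ->
  measurable [set t | a < max_weight (fun i => w i t)] /\
  fine (Q [set t | a < max_weight (fun i => w i t)]) <=
  n%:R * fine (P [set t | a < X t]).
Proof.
move=> a0; set E := [set t | _].
have EU : E = \big[setU/set0]_(i < n) [set t | a < w i t].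
  rewrite -bigcup_seq; apply/seteqP; split => t.
    rewrite /E/= ltNge /max_weight => /negP h; apply: contrapT => h'.
    apply: h; apply: bigmax_le => // i _; rewrite leNgt; apply/negP => ai.
    by apply: h'; exists i => //=; rewrite mem_index_enum.
  move=> [i _ /= ai]; rewrite /E/= (lt_le_trans ai)//.
  exact: (le_bigmax _ (fun i => w i t)).
have mE : measurable E.
  by rewrite EU; apply: bigsetU_measurable => i _; exact: measurable_gt.
split=> //.
have mA i : measurable [set t | a < w i t] by exact: measurable_gt.
have EA t : E t -> (exists i, a < w i t) \/ set0 t.
  by rewrite EU -bigcup_seq => -[i _ ai]; left; exists i.
apply: (le_trans (union_bound Q mA measurable0 mE EA)).
rewrite measure0 addr0; under eq_bigr do rewrite prob_gtE.
by rewrite sumr_const card_ord mulr_natl.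
Qed.

(** The second moment of the indicator of w_i <= x is at most 1. *)
Lemma emp_cdf_weak_law x e : 0 < e ->
  measurable [set t | e < `|emp_cdf (fun i => w i t) x - distr_fun X x|] /\
  fine (Q [set t | e < `|emp_cdf (fun i => w i t) x - distr_fun X x|]) <=
  (n%:R * e ^+ 2)^-1.
Proof.
move=> e0; pose f : R -> R := \1_(`]-oo, x]).
have mf : measurable_fun setT f by exact: measurable_indic.
have f0 y : 0 <= f y by rewrite /f.
have f1 y : f y <= 1 by rewrite /f indicE lern1 leq_b1.
have EE t : emp_cdf (fun i => w i t) x = n%:R^-1 * \sum_(i < n) f (w i t).
  rewrite /emp_cdf -sum1_card natr_sum big_mkcond/=; congr (_ * _).
  apply: eq_bigr => i _; rewrite inE /f indicE.
  have -> : (w i t \in `]-oo, x]%classic) = (w i t <= x).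
    apply/idP/idP => [/set_mem|h]; rewrite /= ?in_itv//.
    by apply: mem_set; rewrite /= in_itv.
  by case: (_ <= _).
have FE : distr_fun X x = \int[P]_t f (X t).
  transitivity (fine (P (X @^-1` `]-oo, x]))) => //.
  by rewrite -Rintegral_indic//; exact: measurable_funPTI.
under eq_fun do rewrite EE FE.
split.
  apply: measurable_lt_set => //.
  exact: measurable_mean_dev.
apply: (le_trans (weak_law iid mf f0 f1 n_gt0 e0)).
rewrite -[leRHS]mul1r ler_pM2r ?invr_gt0 ?mulr_gt0 ?exprn_gt0//.
rewrite -(Rintegral_cst_prob P 1); apply: le_Rintegral => //.
- apply: (@bounded_integrable _ _ _ _ _ 1).
    by apply: measurable_funX; exact: measurableT_comp.
  by move=> t; rewrite normrX exprn_ile1// ger0_norm.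
- by apply: (@bounded_integrable _ _ _ _ _ 1) => // t; rewrite normr1.
- by move=> t _; rewrite exprn_ile1.
Qed.

(** The deviation of the k-th empirical moment splits into the event that some
    weight exceeds the cut, the deviation of the truncated moment, handled by
    the second moment bound, and the deterministic bias of the truncation. The
    tail is at most delta^4, one power of delta more than the normalization
    A^3 = delta^3 n, so that n P(X > A) <= delta. *)
Lemma emp_moment_bound N delta p k e :
  0 < N -> N ^+ 3 = n%:R -> 0 < delta -> delta <= 1 -> 1 <= delta * N ->
  (2 <= p <= 3)%N -> (k <= p)%N ->
  tail_moment X (delta * N) <= delta ^+ 4 -> 0 < e -> delta <= e / 2 ->
  let E := [set t | e <
    `|emp_moment (fun i => w i t) k - moment X k| * N ^+ (3 - p)] in
  measurable E /\
  fine (Q E) <= delta * (1 + 4 * (1 + moment X 3) / e ^+ 2).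
Proof.
move=> N0 N3 d0 d1 A1 p23 kp tA e0 de E; set A := delta * N in A1 tA *.
have /andP[p2 p3] := p23; have A0 : 0 <= A by exact: le_trans A1.
pose f := trunc_power A k; pose m := \int[P]_t f (X t).
pose r := N ^+ (3 - p); have r0 : 0 < r by rewrite exprn_gt0.
pose e' := e / (2 * r); have e'0 : 0 < e' by rewrite divr_gt0 ?mulr_gt0.
have mf : measurable_fun setT f by exact: measurable_trunc_power.
have f0 y : 0 <= f y by exact: trunc_power_ge0.
have fA y : f y <= A ^+ k by exact: trunc_power_le.
pose D := [set t | e' < `|n%:R^-1 * (\sum_(i < n) f (w i t)) - m|].
have mD : measurable D.
  apply: measurable_lt_set => //.
  exact: measurable_mean_dev.
have mE : measurable E.
  apply: measurable_lt_set => //.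
  apply: measurable_funM => //; apply: measurableT_comp => //.
  apply: measurable_funB => //; apply: measurable_funM => //.
  by apply: measurable_sum => i; exact: measurable_funX.
split=> //.
pose B i := w i @^-1` (~` `[0, A]).
have mB i : measurable (B i).
  by apply: measurable_funPTI; apply: measurableC.
have EBD t : E t -> (exists i, B i t) \/ D t.
  move=> Et; have [|nB] := pselect (exists i, B i t); first by left.
  right; rewrite /D/= ltNge; apply/negP => De.
  move: Et; rewrite /E/= ltNge => /negP; apply.
  have -> : emp_moment (fun i => w i t) k = n%:R^-1 * (\sum_(i < n) f (w i t)).
    congr (_ * _); apply: eq_bigr => i _.
    have : `[0, A]%classic (w i t).
      by apply: contrapT => h; apply: nB; exists i.
    by rewrite /= in_itv/= => /andP[w0 wA]; rewrite /f trunc_power_in.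
  set a := n%:R^-1 * _ in De *.
  have bias : r * (moment X k - m) <= delta.
    rewrite /m trunc_moment ?(leq_trans kp)// opprB addrC subrK.
    have := tail_power_cut X_ge0 X3_int d0 d1 A1 (c := delta) p23 kp.
    rewrite -exprSr => /(_ tA (ltW d0)) /le_trans; apply.
    by rewrite ler_piMl// ltW.
  have mle : 0 <= moment X k - m.
    rewrite /m trunc_moment ?(leq_trans kp)// opprB addrC subrK.
    by apply: Rintegral_ge0 => t' _; rewrite mulr_ge0 ?exprn_ge0.
  have De2 : `|a - m| * r <= e / 2.
    have -> : e / 2 = e' * r by rewrite /e' invfM; field; rewrite gt_eqF.
    by rewrite ler_pM2r.
  have tri : `|a - moment X k| <= `|a - m| + (moment X k - m).
    by have := ler_distD m a (moment X k); rewrite (distrC m) (ger0_norm mle).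
  rewrite -/r; apply: (le_trans (ler_wpM2r (ltW r0) tri)).
  by rewrite mulrDl [X in _ + X]mulrC; lra.
apply: (le_trans (union_bound Q mB mD mE EBD)).
rewrite mulrDr mulr1; apply: lerD.
  have PB i : fine (Q (B i)) = fine (P [set t | A < X t]).
    rewrite /B (same_law_prob (iid.2 i)); last exact: measurableC.
    congr (fine (P _)); apply/seteqP; split => t /=; rewrite in_itv/= X_ge0/=.
      by move/negP; rewrite -ltNge.
    by move=> AX; apply/negP; rewrite -ltNge.
  under eq_bigr do rewrite PB.
  rewrite sumr_const card_ord -mulr_natl.
  by apply: prob_gt_cut => //; rewrite -exprSr.
apply: (le_trans (weak_law iid mf f0 fA n_gt0 e'0)).
have m3 : 0 <= moment X 3.
  by rewrite momentE; apply: Rintegral_ge0 => t _; rewrite exprn_ge0.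
have := trunc_moment2_le X_ge0 X3_int A1 p23 kp; rewrite -/f => f2.
have ne0 : 0 < n%:R * e' ^+ 2 by rewrite mulr_gt0 ?exprn_gt0.
rewrite ler_pdivrMr//; apply: (le_trans f2).
(* both sides carry the same power of N, which leaves powers of delta only *)
have -> : delta * (4 * (1 + moment X 3) / e ^+ 2) * (n%:R * e' ^+ 2) =
   (delta * (n%:R / r ^+ 2)) * (1 + moment X 3).
  by rewrite /e'; field; rewrite !gt_eqF.
rewrite ler_wpM2r ?addr_ge0//.
have d30 : 0 <= delta ^+ 2 by exact: sqr_ge0.
rewrite -N3 /r /A; move: p23; case: (p) => [|[|[|[|]]]]//= _.
  rewrite le_eqVlt; apply/orP; left; apply/eqP.
  by rewrite /= !expr1; field; rewrite gt_eqF.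
rewrite /= !expr0 expr1n divr1 exprMn ler_wpM2r ?exprn_ge0 ?(ltW N0)//.
by rewrite -[leRHS]expr1 ler_wiXn2l// ltW.
Qed.

End IidBounds.

(** * Limits *)

Section CubeRoot.
Context {R : realType}.

Definition cbrt n : R := n%:R `^ (1 / 3).

Lemma cbrt_gt0 n : (0 < n)%N -> 0 < cbrt n.
Proof. by move=> n0; rewrite powR_gt0// ltr0n. Qed.

Lemma cbrtX3 n : cbrt n ^+ 3 = n%:R.
Proof.
rewrite /cbrt -powR_mulrn ?powR_ge0// -powRrM.
by rewrite div1r mulVf ?pnatr_eq0// powRr1.
Qed.

Lemma near_cbrt_gt (M : R) : \forall n \near \oo, M < cbrt n.
Proof.
near=> n; rewrite ltNge; apply/negP => nM.
have n_gt : M ^+ 3 < n%:R by near: n; exact: nbhs_infty_gtr.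
have c0 : 0 <= cbrt n by exact: powR_ge0.
have := n_gt; rewrite -cbrtX3 ltNge => /negP; apply.
by rewrite lerXn2r ?nnegrE// (le_trans c0).
Unshelve. all: by end_near. Qed.

Lemma near_cbrt_pinfty (Pr : R -> Prop) (delta : R) : 0 < delta ->
  (\forall A \near +oo, Pr A) -> \forall n \near \oo, Pr (delta * cbrt n).
Proof.
move=> d0 [M [_ PM]]; near=> n; apply: PM.
rewrite -ltr_pdivrMl//; near: n; exact: near_cbrt_gt.
Unshelve. all: by end_near. Qed.

End CubeRoot.

Section InProb.
Context {R : realType} {d : nat -> measure_display}.
Context {T : forall n, measurableType (d n)}.
Variable Q : forall n, probability (T n) R.

(** Measurability makes the probability a finite number, so that convergence can
    be checked on real numbers: the values of a probability on other sets are
    unconstrained. *)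
Lemma cvg_in_probP (Y : forall n, T n -> R) (c : R) :
  (forall e s : R, 0 < e -> 0 < s -> \forall n \near \oo,
     measurable [set t | e < `|Y n t - c|] /\
     fine (Q n [set t | e < `|Y n t - c|]) <= s) ->
  cvg_in_prob Q Y c.
Proof.
move=> h e e0; apply/fine_cvgP; split.
  near=> n; apply: fin_num_measure; near: n.
  by apply: filterS (h e 1 e0 ltr01) => n [].
apply/cvgr0Pnorm_le => s s0; apply: filterS (h e s e0 s0) => n [_ /=].
by rewrite ger0_norm// fine_ge0.
Unshelve. all: by end_near. Qed.
End InProb.

Section Nonneg.
Context (R : realType) d (T : measurableType d) (P : probability T R).
Variable X : {RV P >-> R}.
Hypothesis X_ge0 : forall t, 0 <= X t.
Hypothesis X3_int : P.-integrable setT (EFin \o (fun t => X t ^+ 3)).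
Let F := distr_fun X.

Let m3_ge0 : 0 <= moment X 3.
Proof. by rewrite momentE; apply: Rintegral_ge0 => t _; rewrite exprn_ge0. Qed.

(** For a fixed delta, the hypotheses that the bounds above make on the cut
    A = delta n^(1/3) hold eventually. *)
Lemma near_cut (delta c : R) : 0 < delta -> 0 < c ->
  \forall n \near \oo, [/\ (0 < n)%N, 1 <= delta * cbrt n :> R &
    tail_moment X (delta * cbrt n) <= c].
Proof.
move=> d0 c0; near=> n; split.
- by near: n; exact: nbhs_infty_gt.
- near: n; apply: (near_cbrt_pinfty (Pr := fun A => 1 <= A)) => //.
  exact: nbhs_pinfty_ge.
- near: n.
  apply: (near_cbrt_pinfty (Pr := fun A => tail_moment X A <= c)) => //.
  exact: tail_moment_cvg0.
Unshelve. all: by end_near. Qed.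

Lemma max_weight_ge0 n (v : 'I_n -> R) : 0 <= max_weight v.
Proof. by rewrite /max_weight; exact: bigmax_ge_id. Qed.

Section Deterministic.
Let w := quantile_weights F.

Lemma quantile_max_condition : max_condition w.
Proof.
apply/eqoP => e e0; near=> n.
have [n0 A1 tA] : [/\ (0 < n)%N, 1 <= e * cbrt n &
    tail_moment X (e * cbrt n) <= e ^+ 3].
  by near: n; apply: near_cut => //; exact: exprn_gt0.
have c0 : 0 < cbrt n :> R by exact: cbrt_gt0.
rewrite (ger0_norm (max_weight_ge0 _)) -/(cbrt n) (gtr0_norm c0).
apply: bigmax_le => [|i _]; first by rewrite mulr_ge0// ltW.
exact: (quantile_weights_le_cut X_ge0 X3_int n0 (cbrtX3 n) e0 A1).
Unshelve. all: by end_near. Qed.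

Lemma quantile_weak_cvg : weak_cvg_condition X w.
Proof.
move=> x _; apply/cvgrPdist_le => e e0; near=> n.
have n0 : (0 < n)%N by near: n; exact: nbhs_infty_gt.
rewrite distrC (le_trans (emp_cdf_quantile_close X_ge0 x n0))//.
rewrite invf_ple ?posrE ?ltr0n//; near: n; exact: nbhs_infty_ger.
Unshelve. all: by end_near. Qed.

Lemma quantile_moment_near p k e : (2 <= p <= 3)%N -> (0 < k <= p)%N -> 0 < e ->
  \forall n \near \oo, (0 < n)%N /\
    `|emp_moment (@w n) k - moment X k| * cbrt n ^+ (3 - p) <= e.
Proof.
move=> p23 kp e0; pose delta := Num.min 1 (e / 3).
have d0 : 0 < delta by rewrite lt_min ltr01 divr_gt0.
have d1 : delta <= 1 by rewrite ge_min lexx.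
have de : 3 * delta <= e by rewrite mulrC -ler_pdivlMr// ge_min lexx orbT.
have : \forall n \near \oo, [/\ (0 < n)%N, 1 <= delta * cbrt n &
    tail_moment X (delta * cbrt n) <= delta ^+ 3].
  by apply: near_cut => //; exact: exprn_gt0.
apply: filterS => n [n0 A1 tA]; split=> //; apply: le_trans de.
exact: (quantile_moment_rate X_ge0 X3_int n0 (cbrt_gt0 n0) (cbrtX3 n)).
Qed.

Lemma quantile_moment_condition : moment_condition X w.
Proof.
have H k : (0 < k <= 2)%N -> (fun n => emp_moment (@w n) k - moment X k)
        =o_\oo (fun n => n%:R `^ (- (1 / 3))).
  move=> k2; apply/eqoP => e e0.
  have := @quantile_moment_near 2 k e isT k2 e0.
  apply: filterS => n [n0]; rewrite expr1 powRN -/(cbrt n).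
  by rewrite normfV (gtr0_norm (cbrt_gt0 n0)) -ler_pdivlMr ?cbrt_gt0.
split; [exact: H | exact: H |].
apply/eqoP => e e0; have := @quantile_moment_near 3 3 e isT isT e0.
by apply: filterS => n [_]; rewrite expr0 mulr1 normr1 mulr1.
Qed.

End Deterministic.

Section Random.
Context {d' : nat -> measure_display} {T' : forall n, measurableType (d' n)}.
Context {Q : forall n, probability (T' n) R}.
Variable w : forall n, 'I_n -> {RV (Q n) >-> R}.
Hypothesis iid : forall n, (0 < n)%N -> iid_copies X (@w n).

Lemma iid_max_condition : max_condition_in_prob w.
Proof.
apply: cvg_in_probP => e s e0 s0.
have : \forall n \near \oo, [/\ (0 < n)%N, 1 <= e * cbrt n &
    tail_moment X (e * cbrt n) <= e ^+ 3 * s].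
  by apply: near_cut => //; rewrite mulr_gt0 ?exprn_gt0.
apply: filterS => n [n0 A1 tA].
have c0 : 0 < cbrt n :> R by exact: cbrt_gt0.
have -> : [set t | e < `| `|max_weight (fun i => @w n i t)| /
                          n%:R `^ (1 / 3) - 0| ] =
          [set t | e * cbrt n < max_weight (fun i => @w n i t)].
  apply/seteqP; split => t /=;
  rewrite subr0 -/(cbrt n) (ger0_norm (max_weight_ge0 _));
  by rewrite ger0_norm ?divr_ge0 ?max_weight_ge0 ?(ltW c0)// ltr_pdivlMr.
have [mE bE] := max_weight_gt_bound (iid n0) (le_trans ler01 A1).
split=> //; apply: (le_trans bE).
exact: (prob_gt_cut X_ge0 X3_int (cbrtX3 n)).
Qed.

Lemma iid_weak_cvg : weak_cvg_condition_in_prob X w.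
Proof.
move=> x _; apply: cvg_in_probP => e s e0 s0; near=> n.
have n0 : (0 < n)%N by near: n; exact: nbhs_infty_gt.
have [mE bE] := emp_cdf_weak_law (iid n0) n0 x e0.
split=> //; apply: (le_trans bE).
have e20 : 0 < e ^+ 2 by rewrite exprn_gt0.
rewrite invf_ple ?posrE ?mulr_gt0 ?ltr0n// -ler_pdivrMr//.
near: n; exact: nbhs_infty_ger.
Unshelve. all: by end_near. Qed.

Lemma iid_moment_near p k e s : (2 <= p <= 3)%N -> (k <= p)%N ->
  0 < e -> 0 < s -> \forall n \near \oo, (0 < n)%N /\
   let E := [set t | e <
    `|emp_moment (fun i => @w n i t) k - moment X k| * cbrt n ^+ (3 - p)] in
  measurable E /\ fine (Q n E) <= s.
Proof.
move=> p23 kp e0 s0; pose K := 1 + 4 * (1 + moment X 3) / e ^+ 2.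
have K0 : 0 < K by rewrite addr_gt0// divr_gt0 ?exprn_gt0// mulr_gt0// ltr_pwDl.
(* e / 2 is the share of the truncation bias, s / K bounds the probability *)
pose delta := Num.min 1 (Num.min (e / 2) (s / K)).
have d0 : 0 < delta by rewrite !lt_min ltr01 !divr_gt0.
have d1 : delta <= 1 by rewrite ge_min lexx.
have de : delta <= e / 2 by rewrite !ge_min lexx orbT.
have ds : delta * K <= s by rewrite -ler_pdivlMr// !ge_min lexx !orbT.
have : \forall n \near \oo, [/\ (0 < n)%N, 1 <= delta * cbrt n &
    tail_moment X (delta * cbrt n) <= delta ^+ 4].
  by apply: near_cut => //; exact: exprn_gt0.
apply: filterS => n [n0 A1 tA]; split=> //=.
have /= [mE bE] := emp_moment_bound X_ge0 X3_int (iid n0) n0 (cbrt_gt0 n0)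
  (cbrtX3 n) d0 d1 A1 p23 kp tA e0 de.
by split=> //; exact: le_trans bE ds.
Qed.

Lemma iid_moment_condition : moment_condition_in_prob X w.
Proof.
have H k : (k <= 2)%N -> littleo_in_prob Q
    (fun n t => emp_moment (fun i => @w n i t) k - moment X k)
    (fun n => n%:R `^ (- (1 / 3))).
  move=> k2; apply: cvg_in_probP => e s e0 s0.
  apply: filterS (@iid_moment_near 2 k e s isT k2 e0 s0) => n [n0].
  set E := [set t | _] => /= h; set E' := [set t | _].
  suff -> : E' = E by [].
  have c0 : 0 < cbrt n :> R by exact: cbrt_gt0.
  have nE (x : R) : `| `|x| * cbrt n| = `|x| * cbrt n.
    by rewrite ger0_norm// mulr_ge0// ltW.
  by apply/seteqP; split => t;
    rewrite /E /E'/= subr0 expr1 powRN -/(cbrt n) invrK nE.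
split; [exact: H | exact: H |].
apply: cvg_in_probP => e s e0 s0.
apply: filterS (@iid_moment_near 3 3 e s isT isT e0 s0) => n [n0].
set E := [set t | _] => /= h; set E' := [set t | _].
suff -> : E' = E by [].
by apply/seteqP; split => t; rewrite /E /E'/= subr0 expr0 mulr1 divr1 normr_id.
Qed.

End Random.
End Nonneg.

(** * Reduction to a nonnegative variable *)

Section PositivePart.
Context (R : realType) d (T : measurableType d) (P : probability T R).
Variable W : {RV P >-> R}.

Definition pos_part (t : T) : R := Num.max 0 (W t).

Lemma measurable_pos_part : measurable_fun setT pos_part.
Proof. exact: measurable_maxr. Qed.

HB.instance Definition _ :=
  isMeasurableFun.Build _ _ _ _ pos_part measurable_pos_part.

Let X : {RV P >-> R} := pos_part.

Hypothesis W_ge0 : {ae P, forall t, 0 <= W t}.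

Lemma pos_part_ae (f : R -> R) : measurable_fun setT f ->
  (\int[P]_t (f (W t))%:E = \int[P]_t (f (X t))%:E)%E.
Proof.
move=> mf; apply: ae_eq_integral => //.
- by apply/measurable_EFinP; exact: measurableT_comp.
- by apply/measurable_EFinP; exact: measurableT_comp.
- by apply: filterS W_ge0 => t W0 _ /=; rewrite /pos_part max_r.
Qed.

Lemma pos_part_same_law : same_law W X.
Proof.
move=> B mB.
have mi : measurable_fun setT (\1_B : R -> R) by exact: measurable_indic.
have := pos_part_ae mi.
have E (Z : {RV P >-> R}) : (\int[P]_t (\1_B (Z t))%:E = distribution P Z B)%E.
  rewrite -[X in distribution P Z X](setIT B).
  rewrite -(integral_indic (distribution P Z))//.
  by rewrite ge0_integral_distribution//; exact/measurable_EFinP.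
by rewrite !E.
Qed.

Lemma pos_part_distr_fun : distr_fun W = distr_fun X.
Proof. by apply/funext => x; rewrite /distr_fun /cdf pos_part_same_law. Qed.

Lemma pos_part_moment k : moment W k = moment X k.
Proof.
rewrite /moment unlock; congr fine.
by apply: (pos_part_ae (f := fun x => x ^+ k)); exact: exprn_measurable.
Qed.

Lemma pos_part_integrable : ('E_P[(fun t => (W t ^+ 3)%R)] < +oo)%E ->
  P.-integrable setT (EFin \o (fun t => X t ^+ 3)).
Proof.
rewrite unlock (pos_part_ae (f := fun x => x ^+ 3)) => [W3|];
  last exact: exprn_measurable.
apply/integrableP; split.
  by apply/measurable_EFinP; exact: measurable_funX.
rewrite (eq_integral (fun t => (X t ^+ 3)%:E))// => t _ /=.
by rewrite ger0_norm// exprn_ge0// le_max lexx.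
Qed.

Lemma pos_part_iid d' (T' : measurableType d') (Q : probability T' R) n
  (w : 'I_n -> {RV Q >-> R}) : iid_copies W w -> iid_copies X w.
Proof.
by move=> [ind law]; split=> // i B mB; rewrite law// pos_part_same_law.
Qed.

End PositivePart.

Theorem corollary1p2 (R : realType) (d : measure_display)
    (T : measurableType d) (P : probability T R) (W : {RV P >-> R})
    (W_ge0 : {ae P, forall t, 0 <= W t})
    (W3_fin : ('E_P[(fun t => (W t ^+ 3)%R)] < +oo)%E) :
  (let w := quantile_weights (distr_fun W) in
   [/\ max_condition w,
       weak_cvg_condition W w &
       moment_condition W w])
  /\
  (forall (d' : nat -> measure_display)
      (T' : forall n : nat, measurableType (d' n))
      (Q : forall n : nat, probability (T' n) R)
      (w : forall n : nat, 'I_n -> {RV (Q n) >-> R}),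
    (forall n : nat, (0 < n)%N -> iid_copies W (w n)) ->
    [/\ max_condition_in_prob w,
        weak_cvg_condition_in_prob W w &
        moment_condition_in_prob W w]).
Proof.
pose X : {RV P >-> R} := pos_part W.
have X_ge0 t : 0 <= X t by rewrite /X/= le_max lexx.
have X3 := pos_part_integrable W_ge0 W3_fin.
have FE := pos_part_distr_fun W_ge0; have mE := pos_part_moment W_ge0.
rewrite /weak_cvg_condition /moment_condition /weak_cvg_condition_in_prob.
rewrite /moment_condition_in_prob FE !mE; split.
  split; [exact: quantile_max_condition | exact: quantile_weak_cvg |
          exact: quantile_moment_condition].
move=> d' T' Q w iidW.
have iid n : (0 < n)%N -> iid_copies X (w n).
  by move=> n0; apply: pos_part_iid => //; exact: iidW.
split; [exact: iid_max_condition iid | exact: iid_weak_cvg iid |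
        exact: iid_moment_condition iid].
Qed.
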